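(* Let $d\ge 1$ and let $m,k_1,\dots,k_d$ be nonnegative integers. Let $x\in\mathbb{C}$ with $\Re(x)>0$ and $s\in\mathbb{C}$ with $\Re(s)>m+k_1+\cdots+k_d+d$. Then $$\sum_{\substack{m_1+\cdots+m_d=m\\ m_1,\dots,m_d\ge 0}}\binom{m}{m_1,\dots,m_d}Z_{m_1+k_1,\dots,m_d+k_d}(s,x)=\sum_{k=0}^m\binom{m}{k}(-1)^k x^{m-k}Z_{k_1,\dots,k_d}(s-k,x).$$
   Context: Let $G(t)=\dfrac{t}{1-e^{-t}}$ for $t>0$ (extended by $G(0)=1$), and $G^{(j)}$ its $j$-th derivative. For nonnegative integers $n_1,\dots,n_d$, define $$Z_{n_1,\dots,n_d}(s,x)=\frac{1}{\Gamma(s)}\int_0^\infty t^{s-1}G^{(n_1)}(t)\cdots G^{(n_d)}(t)e^{-xt}\,dt$$ for $\Re(s)>n_1+\cdots+n_d+d$ and $\Re(x)>0$. $\binom{m}{m_1,\dots,m_d}$ is the multinomial coefficient. *)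

(* Defs.v *)
From mathcomp Require Import all_boot all_order all_algebra.
From mathcomp Require Import complex.
From mathcomp Require Import all_classical all_reals all_analysis.

Set Implicit Arguments.
Unset Strict Implicit.
Unset Printing Implicit Defensive.

Import Order.TTheory GRing.Theory Num.Theory.
Import numFieldNormedType.Exports.

Local Open Scope classical_set_scope.
Local Open Scope ring_scope.
Local Open Scope complex_scope.

Definition cexp (R : realType) (z : R[i]) : R[i] :=
  (expR (complex.Re z) * cos (complex.Im z)) +i*
  (expR (complex.Re z) * sin (complex.Im z)).

(* t ^ s with the principal (real) logarithm of t; meant for t > 0, since
   ln t = 0 for t <= 0. *)
Definition rcpow (R : realType) (t : R) (s : R[i]) : R[i] :=
  cexp (s * (ln t)%:C).

(* Lebesgue integral of a complex-valued function on ]0, +oo[, taken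
   componentwise. *)
Definition cintegral0y (R : realType) (f : R -> R[i]) : R[i] :=
  (\int[lebesgue_measure]_(t in `]0, +oo[) complex.Re (f t))%R +i*
  (\int[lebesgue_measure]_(t in `]0, +oo[) complex.Im (f t))%R.

(* Euler's integral; only meaningful for 0 < Re s. *)
Definition cGamma (R : realType) (s : R[i]) : R[i] :=
  cintegral0y (fun t : R => rcpow t (s - 1) * cexp (- t%:C)).

Definition G (R : realType) (t : R) : R :=
  if t == 0 then 1 else t / (1 - expR (- t)).

(* Only meaningful for 0 < Re x and \sum_i n i + d < Re s. *)
Definition Z (R : realType) (d : nat) (n : 'I_d -> nat) (s x : R[i]) : R[i] :=
  (cGamma s)^-1 *
  cintegral0y (fun t : R =>
    rcpow t (s - 1) * (\prod_(i < d) derive1n (n i) (@G R) t)%:C * cexp (- (x * t%:C))).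

Definition multinomial (m d : nat) (p : 'I_d -> nat) : nat :=
  (m`! %/ \prod_(i < d) (p i)`!)%N.

(* Main.v *)
Require Import Defs.
From mathcomp Require Import all_boot all_order all_algebra.
From mathcomp Require Import complex.
From mathcomp Require Import all_classical all_reals all_analysis.
From mathcomp Require Import measurable_realfun ring lra.

                                                                 
                                                            
                                       
                                                             
                                                                               
                                                                                
                                                                               
                                                  

Set Implicit Arguments.
Unset Strict Implicit.
Unset Printing Implicit Defensive.

Import Order.TTheory GRing.Theory Num.Theory.
Import numFieldNormedType.Exports.

Local Open Scope ring_scope.
Local Open Scope complex_scope.

(** Write [F_n(t)] for the product of the derivatives [G^(n_i)(t)] and [e_i] for the i-th unit
    vector. By the Leibniz rule, [F_n' = \sum_i F_(n+e_i)]. The function [t^(s-1) F_n(t) e^(-xt)]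
    vanishes at both ends of the half line, so its derivative integrates to 0; this is integration
    by parts without boundary terms ([laplace_mellin_parts]). Dividing by
    [Gamma(s) = (s-1) Gamma(s-1)] ([cGammaS]) gives [Z_recurrence]: [\sum_i Z_(n+e_i)(s,x) = x
    Z_n(s,x) - Z_n(s-1,x)].

    Thus raising one index in all possible ways acts on [Z] as the operator [x - T], where [T]
    shifts [s] to [s-1]. The multinomial sum is the m-fold iteration of that raising
    ([composition_sumS]), and the right-hand side is the binomial expansion of [(x - T)^m];
    [composition_sum_Z] proves the match by induction on [m] and Pascal's rule.

    The analytic input is a bound on [G^(n)] near 0 and at infinity. With [g = 1/(1-e^(-t))] one has
    [G = t g] and [g' = g - g^2], so each [G^(n)] is [t P(g) + Q(g)] for polynomials of controlled
    degree. As [t g <= 1 + t], this gives [derive1n_G_bound], which yields integrability and the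
    vanishing boundary terms. *)

(** * Factorials and weighted sums over compositions *)

Lemma prod_fact_dvd (I : Type) (r : seq I) (p : I -> nat) :
  (\prod_(i <- r) (p i)`! %| (\sum_(i <- r) p i)`!)%N.
Proof.
elim: r => [|i r IH]; first by rewrite !big_nil.
rewrite !big_cons -(bin_fact (leq_addr (\sum_(j <- r) p j)%N (p i))) addKn.
by apply: dvdn_mull; apply: dvdn_mul.
Qed.

Definition incr (d : nat) (i : 'I_d) (n : 'I_d -> nat) : 'I_d -> nat :=
  fun j => (n j + (j == i))%N.

Lemma sum_incr (d : nat) (i : 'I_d) (n : 'I_d -> nat) :
  (\sum_j incr i n j = (\sum_j n j).+1)%N.
Proof.
rewrite big_split /= -addn1; congr addn.
by rewrite (bigD1 i) //= eqxx big1 // => j /negPf ->.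
Qed.

Section CompositionSum.
Variables (F : numFieldType) (d N : nat).
Implicit Types (f : ('I_d -> nat) -> F) (p : {ffun 'I_d -> 'I_N.+1}).

Let wt p : F := \prod_(i < d) ((p i)`!%:R)^-1.

(** The multinomial sum divided by [m!]. The bound [N] on the parts is kept independent of [m], so
    that an induction on [m] stays within one index type. *)
Definition composition_sum (m : nat) f : F :=
  \sum_(p : {ffun 'I_d -> 'I_N.+1} | (\sum_(i < d) p i)%N == m)
    wt p * f (fun i => p i : nat).

Let up (i : 'I_d) p : {ffun 'I_d -> 'I_N.+1} :=
  [ffun j => if j == i then inord (p j).+1 else p j].
Let down (i : 'I_d) p : {ffun 'I_d -> 'I_N.+1} :=
  [ffun j => if j == i then inord (p j).-1 else p j].

Let upE i p : (p i < N)%N -> (fun j => up i p j : nat) = incr i (fun j => p j : nat).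
Proof.
move=> h; apply: funext => j; rewrite /incr ffunE.
case: eqP => [->|_]; last by rewrite addn0.
by rewrite inordK ?addn1.
Qed.

Let sum_up i p : (p i < N)%N -> (\sum_j up i p j = (\sum_j p j).+1)%N.
Proof.
move=> h; rewrite -(sum_incr i (fun j => p j : nat)).
by apply: eq_bigr => j _; rewrite -(upE h).
Qed.

Let wtE i p : (0 < p i)%N -> (p i)%:R * wt p = wt (down i p).
Proof.
move=> h; rewrite /wt (bigD1 i) //= [in RHS](bigD1 i) //= mulrA; congr (_ * _); last first.
  by apply: eq_bigr => j /negPf ji; rewrite ffunE ji.
rewrite ffunE eqxx inordK; last exact: leq_ltn_trans (leq_pred _) (ltn_ord _).
case: (p i : nat) h => // n _.
by rewrite factS natrM invfM mulrA divff ?mul1r // pnatr_eq0.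
Qed.

(** Write [m.+1] as the sum of the parts [p i]. The factor [p i] cancels against [(p i)!], leaving
    the weight of [p] with its i-th part lowered; terms with [p i = 0] disappear, and on the others
    lowering is inverse to [up i]. *)
Lemma composition_sumS (m : nat) f : (m < N)%N ->
  m.+1%:R * composition_sum m.+1 f =
  \sum_(i < d) composition_sum m (fun n => f (incr i n)).
Proof.
move=> mN; rewrite /composition_sum mulr_sumr.
transitivity (\sum_(i < d) \sum_(p : {ffun 'I_d -> 'I_N.+1} | (\sum_(i < d) p i)%N == m.+1)
   (p i)%:R * wt p * f (fun i => p i : nat)).
  rewrite exchange_big /=; apply: eq_bigr => p /eqP <-.
  by rewrite -!mulr_suml natr_sum mulrA.
apply: eq_bigr => i _.
rewrite (bigID (fun p : {ffun 'I_d -> 'I_N.+1} => (0 < p i)%N)) /=.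
rewrite [X in _ + X]big1 ?addr0; last first.
  by move=> p /andP[_]; rewrite lt0n negbK => /eqP ->; rewrite !mul0r.
have le_i p : (p i <= \sum_j p j)%N by rewrite (bigD1 i) //= leq_addr.
rewrite (reindex_onto (up i) (down i)) /=; last first.
  move=> p /andP[_ p0]; apply/ffunP => j; rewrite !ffunE; case: eqP => [->|//].
  rewrite inordK ?(leq_ltn_trans (leq_pred _)) ?ltn_ord // prednK //.
  by apply: val_inj; rewrite /= inordK.
apply: eq_big => [p|p /andP[/andP[/eqP hs h0] /eqP hd]].
  apply/idP/idP.
    case/andP => /andP[/eqP hs h0] /eqP hd.
    suff pN : (p i < N)%N.
      by move: hs; rewrite (sum_up pN) => -[->].
    (* If [p i] were [N], then [inord N.+1] would fall back to 0, contradicting the positivity of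
       the i-th entry of [up i p]. *)
    rewrite ltnNge; apply/negP => Np; move: h0.
    by rewrite ffunE eqxx /inord val_insubd ifF // ltnS; apply/negbTE; rewrite -leqNgt.
  move=> /eqP hs.
  have pN : (p i < N)%N by rewrite (leq_ltn_trans (le_i p)) ?hs.
  rewrite (sum_up pN) hs eqxx /=; apply/andP; split.
    by rewrite ffunE eqxx inordK.
  apply/eqP/ffunP => j; rewrite !ffunE; case: eqP => [->|//].
  by apply: val_inj; rewrite /= !inordK //= ltn_ord.
have pN : (p i < N)%N.
  rewrite ltnNge; apply/negP => Np; move: h0.
  by rewrite ffunE eqxx /inord val_insubd ifF // ltnS; apply/negbTE; rewrite -leqNgt.
by rewrite wtE // hd upE.
Qed.

End CompositionSum.

(** * Integrals of derivatives over the half line *)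

Section HalfLine.
Local Open Scope classical_set_scope.
Variable R : realType.
Implicit Types (f H : R -> R) (c M a t : R).
Notation mu := (@lebesgue_measure R).

Lemma is_derive_continuous f t (l : R) :
  is_derive t 1 f l -> {for t, continuous f}.
Proof. by move=> [df _]; exact/differentiable_continuous/derivable1_diffP. Qed.

Lemma is_derive_expRN c t : c != 0 ->
  is_derive t 1 (fun u => - (c^-1 * expR (- (c * u)))) (expR (- (c * t))).
Proof.
move=> c0; have h : is_derive t 1 (fun u : R => - (c * u)) (- c).
  by apply: is_derive_eq; rewrite scaler1.
have h2 := @is_derive1_comp R expR _ t _ _ (is_derive_expR _) h.
have h3 := is_deriveN (is_deriveZ c^-1 h2).
apply: (@is_derive_eq _ _ _ _ _ _ _ _ h3).
by rewrite /GRing.scale /= mulrN -!mulNr; field.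
Qed.

Lemma cvg_expRN_pinfty c : 0 < c -> expR (- (c * t)) @[t --> +oo] --> (0 : R).
Proof.
move=> c0; apply: (@cvg_comp _ _ _ (fun z => c * z) (fun z => expR (- z)) _ (pinfty_nbhs R)).
  exact: gt0_cvgMry.
exact: cvgr_expR.
Qed.

Lemma continuous_expRN c t : {for t, continuous (fun u => expR (- (c * u)))}.
Proof.
apply: (@continuous_comp _ _ _ (fun u : R => - (c * u)) expR); last exact: continuous_expR.
apply: continuousN; apply: continuousM => //; exact: cst_continuous.
Qed.

(** The bound is imposed on the whole open half line, so it also excludes any blow-up at 0. *)
Definition exp_decay f : Prop :=
  exists M c, 0 < c /\ forall t, 0 < t -> `|f t| <= M * expR (- (c * t)).

Definition half_continuous f : Prop :=
  forall t, 0 < t -> {for t, continuous f}.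

Lemma half_continuous_measurable f : half_continuous f -> measurable_fun (`]0, +oo[ : set R) f.
Proof.
move=> cf; apply: open_continuous_measurable_fun; first exact: interval_open.
by move=> t; rewrite inE /= in_itv /= andbT; apply: cf.
Qed.

Lemma integrable_expRN c : 0 < c ->
  mu.-integrable `]0, +oo[ (EFin \o (fun t => expR (- (c * t)))).
Proof.
move=> c0.
have mf : measurable_fun (`]0, +oo[ : set R) (fun t => expR (- (c * t))).
  by apply: half_continuous_measurable => t _; exact: continuous_expRN.
apply/integrableP; split; first exact/measurable_EFinP.
under eq_integral do rewrite /= ger0_norm ?expR_ge0//.
rewrite integral_itv_obnd_cbnd; last exact/measurable_EFinP.
rewrite (@ge0_continuous_FTC2y _ _ (fun u => - (c^-1 * expR (- (c * u)))) 0 0) //.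
- by rewrite -EFinB ltry.
- apply/continuous_within_itvcyP; split.
    by move=> t _; exact: continuous_expRN.
  by apply: cvg_at_right_filter; exact: continuous_expRN.
- rewrite -[X in _ --> X]oppr0 -[X in _ --> - X](mulr0 c^-1).
  apply: cvgN; apply: cvgM; [exact: cvg_cst|exact: cvg_expRN_pinfty].
- apply: cvg_at_right_filter; apply: cvgN; apply: cvgM; first exact: cvg_cst.
  exact: continuous_expRN.
- move=> t _; rewrite derive1E; apply: derive_val; apply: is_derive_expRN.
  by rewrite gt_eqF.
Qed.

Lemma integrable_MexpRN M c : 0 < c ->
  mu.-integrable `]0, +oo[ (EFin \o (fun t => M * expR (- (c * t)))).
Proof.
move=> c0.
rewrite (_ : EFin \o _ =
  (fun t => M%:E * (EFin \o (fun t => expR (- (c * t)))) t)%E); last first.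
  by apply: funext => t /=; rewrite EFinM.
by apply: integrableZl => //; exact: integrable_expRN.
Qed.

Lemma exp_decay_integrable f : half_continuous f -> exp_decay f ->
  mu.-integrable `]0, +oo[ (EFin \o f).
Proof.
move=> cf [M [c [c0 fb]]].
have M0 : 0 <= M.
  have := le_trans (normr_ge0 _) (fb 1 ltr01).
  by rewrite pmulr_lge0 ?expR_gt0.
apply: le_integrable (integrable_MexpRN M c0) => //.
  by apply/measurable_EFinP; apply: half_continuous_measurable.
move=> t /=; rewrite in_itv /= andbT => t0.
by rewrite lee_fin [leRHS]ger0_norm ?fb // mulr_ge0 ?expR_ge0.
Qed.

                                                                              
                                                                           
(** The fundamental theorem of calculus on a half line is applied to nonnegative integrands. Adding
    the majorant [M e^(-ct)] makes [f] nonnegative; the explicitly known integral of the majorant is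
    then subtracted. *)
Lemma Rintegral_tail f H a M c : 0 < a -> 0 < c ->
  (forall t, 0 < t -> is_derive t 1 H (f t)) -> half_continuous f ->
  (forall t, 0 < t -> `|f t| <= M * expR (- (c * t))) ->
  (forall t, 0 < t -> `|H t| <= M * expR (- (c * t))) ->
  \int[mu]_(t in `[a, +oo[) f t = - H a.
Proof.
move=> a0 c0 dH cf fb Hb.
have cn0 : c != 0 by rewrite gt_eqF.
have M0 : 0 <= M.
  have := le_trans (normr_ge0 _) (fb 1 ltr01).
  by rewrite pmulr_lge0 ?expR_gt0.
have sub : `[a, +oo[ `<=` (`]0, +oo[ : set R).
  by apply: subset_itvr; rewrite bnd_simp.
have fi : mu.-integrable `[a, +oo[ (EFin \o f).
  apply: (@integrableS _ _ R mu `]0, +oo[) => //.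
  by apply: exp_decay_integrable => //; exists M, c.
have ei : mu.-integrable `[a, +oo[ (EFin \o (fun t => M * expR (- (c * t)))).
  apply: (@integrableS _ _ R mu `]0, +oo[) => //.
  exact: integrable_MexpRN.
have cE t : {for t, continuous (fun t : R => M * expR (- (c * t)))}.
  by apply: continuousM; [exact: cst_continuous|exact: continuous_expRN].
have dE t : is_derive t 1 (fun u => M * - (c^-1 * expR (- (c * u)))) (M * expR (- (c * t))).
  exact: (is_deriveZ M (is_derive_expRN t cn0)).
have lE : M * - (c^-1 * expR (- (c * t))) @[t --> +oo] --> (0 : R).
  rewrite -[X in _ --> X](mulr0 M) -[X in _ --> M * X]oppr0 -[X in _ --> M * - X](mulr0 c^-1).
  apply: cvgM; first exact: cvg_cst.
  by apply: cvgN; apply: cvgM; [exact: cvg_cst|exact: cvg_expRN_pinfty].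
have lH : H t @[t --> +oo] --> (0 : R).
  apply: (@squeeze_cvgr _ _ _ _ (fun t => - (M * expR (- (c * t))))
    (fun t => M * expR (- (c * t)))).
  - near=> t; rewrite -ler_norml; apply: Hb.
    by near: t; exact: nbhs_pinfty_gt.
  - rewrite -[X in _ --> X]oppr0 -[X in _ --> - X](mulr0 M).
    by apply: cvgN; apply: cvgM; [exact: cvg_cst|exact: cvg_expRN_pinfty].
  - rewrite -[X in _ --> X](mulr0 M).
    by apply: cvgM; [exact: cvg_cst|exact: cvg_expRN_pinfty].
have eq1 : \int[mu]_(t in `[a, +oo[) (f t + M * expR (- (c * t))) =
    0 - (H a + M * - (c^-1 * expR (- (c * a)))).
  apply: (@Rintegral_ge0_continuous_FTC2y _ _
    (fun t => H t + M * - (c^-1 * expR (- (c * t))))).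
  - move=> t at_; have t0 := lt_le_trans a0 at_.
    by have := fb t t0; rewrite ler_norml => /andP[+ _]; rewrite -subr_ge0 opprK.
  - apply/continuous_within_itvcyP; split.
      move=> t; rewrite in_itv /= andbT => at_.
      by apply: cvgD; [apply: cf; exact: lt_trans at_|exact: cE].
    apply: cvg_at_right_filter.
    by apply: cvgD; [exact: cf|exact: cE].
  - by rewrite -[X in _ --> X]addr0; apply: cvgD.
  - move=> t at_; have t0 := lt_trans a0 at_.
    exact: (@ex_derive _ _ _ _ _ _ _ (is_deriveD (dH t t0) (dE t))).
  - apply: cvg_at_right_filter; apply: cvgD.
      exact: is_derive_continuous (dH a a0).
    exact: is_derive_continuous (dE a).
  - move=> t; rewrite in_itv /= andbT => at_; have t0 := lt_trans a0 at_.
    rewrite derive1E.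
    exact: (@derive_val _ _ _ _ _ _ _ (is_deriveD (dH t t0) (dE t))).
have eq2 : \int[mu]_(t in `[a, +oo[) (M * expR (- (c * t))) =
    0 - (M * - (c^-1 * expR (- (c * a)))).
  apply: (@Rintegral_ge0_continuous_FTC2y _ _ (fun t => M * - (c^-1 * expR (- (c * t))))).
  - by move=> t _; rewrite mulr_ge0 ?expR_ge0.
  - apply/continuous_within_itvcyP; split; first by move=> t _; exact: cE.
    by apply: cvg_at_right_filter; exact: cE.
  - by [].
  - by move=> t _; exact: (@ex_derive _ _ _ _ _ _ _ (dE t)).
  - apply: cvg_at_right_filter.
    exact: is_derive_continuous (dE a).
  - by move=> t _; rewrite derive1E; exact: (@derive_val _ _ _ _ _ _ _ (dE t)).
move: eq1; rewrite RintegralD // eq2 => /eqP; rewrite -subr_eq0 => /eqP h.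
by apply/eqP; rewrite -subr_eq0 -h; apply/eqP; ring.
Unshelve. all: by end_near. Qed.

(** Cut the integral at a small [a]: the part on []0, a]] is at most [M a] because [f] is bounded by
    [M], and the tail is [- H a], again at most [M a] in absolute value. Let [a] tend to 0. *)
Lemma Rintegral_derive0 f H M c : 0 < c ->
  (forall t, 0 < t -> is_derive t 1 H (f t)) -> half_continuous f ->
  (forall t, 0 < t -> `|f t| <= M * expR (- (c * t))) ->
  (forall t, 0 < t -> `|H t| <= M * expR (- (c * t))) ->
  (forall t, 0 < t -> `|H t| <= M * t) ->
  \int[mu]_(t in `]0, +oo[) f t = 0.
Proof.
move=> c0 dH cf fb Hb Hb0.
have M0 : 0 <= M.
  have := le_trans (normr_ge0 _) (fb 1 ltr01).
  by rewrite pmulr_lge0 ?expR_gt0.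
have fi : mu.-integrable `]0, +oo[ (EFin \o f).
  by apply: exp_decay_integrable => //; exists M, c.
have key a : 0 < a -> `|\int[mu]_(t in `]0, +oo[) f t| <= (M + M) * a.
  move=> a0.
  have sub : `]0, a] `<=` (`]0, +oo[ : set R) by apply: subset_itvl.
  have fia : mu.-integrable `]0, a] (EFin \o f) by apply: (@integrableS _ _ R mu `]0, +oo[).
  have := @Rintegral_itvB R f (BRight 0) (BInfty R false) a fi.
  rewrite !bnd_simp => /(_ (ltW a0) isT) /eqP; rewrite subr_eq => /eqP ->.
  rewrite Rintegral_itv_obnd_cbnd; last first.
    apply: integrableS fi => //.
    by apply: subset_itvr; rewrite bnd_simp ltW.
  rewrite (Rintegral_tail a0 c0 dH cf fb Hb) mulrDl.
  apply: (le_trans (ler_normD _ _)); rewrite normrN lerD ?Hb0 //.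
  apply: (le_trans (le_normr_Rintegral _ fia)) => //.
  have -> : M * a = \int[mu]_(t in `]0, a]) M.
    by rewrite Rintegral_cst //= lebesgue_measure_itv /= lte_fin a0 /= oppr0 addr0.
  apply: le_Rintegral => //.
  - exact: (@integrable_abse _ _ _ mu _ _ fia).
  - apply/integrableP; split; first exact: measurable_cst.
    rewrite integral_cst //= lebesgue_measure_itv /= lte_fin a0.
    by rewrite -EFinB -EFinM ltry.
  - move=> t /=; rewrite in_itv /= => /andP[t0 _].
    apply: (le_trans (fb t t0)); rewrite ler_piMr // -expR0 ler_expR oppr_le0.
    by rewrite mulr_ge0 // ltW.
apply/eqP; rewrite -normr_le0; apply/ler_addgt0Pr => e e0; rewrite add0r.
(* The added 1 keeps the denominator positive when [M = 0]. *)
have MM : 0 < M + M + 1 by lra.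
have := key (e / (M + M + 1)); rewrite divr_gt0 // => /(_ isT) /le_trans; apply.
rewrite mulrA ler_pdivrMr // mulrC ler_pM2l //; lra.
Qed.

End HalfLine.

(** * Closed form and growth of the derivatives of [G] *)

Section DerivativesOfG.
Variable R : realType.
Implicit Types (t : R) (p q : {poly R}) (n N : nat).

Definition Gaux t : R := (1 - expR (- t))^-1.

Lemma expRN_lt1 t : 0 < t -> 0 < 1 - expR (- t).
Proof. by move=> t0; rewrite subr_gt0 -expR0 ltr_expR oppr_lt0. Qed.

Lemma is_derive_Gaux t : 0 < t ->
  is_derive t 1 Gaux (Gaux t - Gaux t ^+ 2).
Proof.
move=> t0; have h0 : 1 - expR (- t) != 0 by rewrite gt_eqF // expRN_lt1.
have h : is_derive t 1 (fun u : R => 1 - expR (- u)) (expR (- t)).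
  have h2 := @is_derive1_comp R expR _ t _ _ (is_derive_expR _) (is_deriveNid t 1).
  have h3 := is_deriveB (is_derive_cst (1 : R) t 1) h2.
  by apply: (@is_derive_eq _ _ _ _ _ _ _ _ h3); rewrite sub0r mulrN mulr1 opprK.
have h4 := @is_deriveV R (fun u : R => 1 - expR (- u)) t _ 1 h0 h.
apply: (@is_derive_eq _ _ _ _ _ _ _ _ h4).
by rewrite /Gaux /GRing.scale /=; field.
Qed.

                                                                            
                                
(** The pair [(P, Q)] with [G^(n) = t P(g) + Q(g)], where [g] is [Gaux]. Since [g' = g - g^2],
    differentiating [P(g)] gives [P' * ('X - 'X^2)] evaluated at [g]; the summand [p] in the second
    component comes from differentiating the factor [t]. *)
Fixpoint Gpolys n : {poly R} * {poly R} :=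
  if n is n'.+1 then
    let: (p, q) := Gpolys n' in
    (p^`() * ('X - 'X^2), p + q^`() * ('X - 'X^2))
  else ('X, 0).

Lemma is_derive_horner_Gaux p t : 0 < t ->
  is_derive t 1 (fun u => p.[Gaux u]) (p^`() * ('X - 'X^2)).[Gaux t].
Proof.
move=> t0.
have h := @is_derive1_comp R (horner p) _ t _ _ (is_derive_poly p _)
  (is_derive_Gaux t0).
apply: (@is_derive_eq _ _ _ _ _ _ _ _ h).
by rewrite !hornerE.
Qed.

Lemma is_derive_Gpolys p q t : 0 < t ->
  is_derive t 1 (fun u => u * p.[Gaux u] + q.[Gaux u])
   (t * (p^`() * ('X - 'X^2)).[Gaux t] + (p + q^`() * ('X - 'X^2)).[Gaux t]).
Proof.
move=> t0.
have h := is_deriveD (is_deriveM (is_derive_id t 1) (is_derive_horner_Gaux p t0))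
  (is_derive_horner_Gaux q t0).
apply: (@is_derive_eq _ _ _ _ _ _ _ _ h).
by rewrite hornerD /GRing.scale /= mulr1 addrA.
Qed.

Lemma derive1n_GE n t : 0 < t ->
  derive1n n (@G R) t = t * (Gpolys n).1.[Gaux t] + (Gpolys n).2.[Gaux t].
Proof.
elim: n t => [|n IH] t t0.
  by rewrite /= !hornerE /G gt_eqF.
rewrite derive1nS derive1E.
suff h : is_derive t 1 (derive1n n (@G R))
    (t * (Gpolys n.+1).1.[Gaux t] + (Gpolys n.+1).2.[Gaux t]).
  exact: (@derive_val _ _ _ _ _ _ _ h).
have := is_derive_Gpolys (Gpolys n).1 (Gpolys n).2 t0.
rewrite /=; case: (Gpolys n) IH => p q /= IH.
(* The closed form holds only for positive arguments, which suffices because derivatives are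
   local. *)
apply: near_eq_is_derive; near=> u; rewrite IH //; near: u; exact: lt_nbhsr.
Unshelve. all: by end_near. Qed.

Lemma is_derive_derive1n_G n t : 0 < t ->
  is_derive t 1 (derive1n n (@G R)) (derive1n n.+1 (@G R) t).
Proof.
move=> t0; rewrite derive1n_GE //.
have := is_derive_Gpolys (Gpolys n).1 (Gpolys n).2 t0.
have := @derive1n_GE n; rewrite /=; case: (Gpolys n) => p q /= GE.
apply: near_eq_is_derive; near=> u; rewrite GE //; near: u; exact: lt_nbhsr.
Unshelve. all: by end_near. Qed.

Lemma Gaux_gt0 t : 0 < t -> 0 < Gaux t.
Proof. by move=> t0; rewrite invr_gt0 expRN_lt1. Qed.

Lemma Gaux_le t : 0 < t -> t * Gaux t <= 1 + t.
Proof.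
move=> t0; rewrite ler_pdivrMr ?expRN_lt1 // mulrBr mulr1.
suff : (1 + t) * expR (- t) <= 1 by lra.
by rewrite expRN ler_pdivrMr ?expR_gt0 // mul1r expR_ge1Dx.
Qed.

Lemma horner_Gaux_bound N p : (size p <= N.+1)%N ->
  exists C, forall t, 0 < t -> t ^+ N * `|p.[Gaux t]| <= C * (1 + t) ^+ N.
Proof.
move=> sp; exists (\sum_(i < N.+1) `|p`_i|) => t t0.
rewrite (horner_coef_wide _ sp) mulr_suml.
apply: (le_trans (ler_wpM2l _ (ler_norm_sum _ _ _))); first by rewrite exprn_ge0 // ltW.
rewrite mulr_sumr; apply: ler_sum => -[i /= iN] _.
rewrite normrM normrX (ger0_norm (ltW (Gaux_gt0 t0))) mulrCA ler_wpM2l //.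
(* Group [t^N g^i] as [t^(N-i) (t g)^i]; both [t] and [t g] are at most [1 + t]. *)
rewrite ltnS in iN; rewrite -{1 2}(subnK iN) !exprD -mulrA -exprMn.
have t1 : t <= 1 + t by rewrite lerDr.
have g0 := Gaux_gt0 t0.
have t0' := ltW t0; have u0 : 0 <= 1 + t by exact: le_trans t1.
have tg0 : 0 <= t * Gaux t by rewrite mulr_ge0 // ltW.
apply: ler_pM; rewrite ?exprn_ge0 // lerXn2r ?nnegrE //.
exact: Gaux_le.
Qed.

Lemma size_Gpolys n : (size (Gpolys n).1 <= n.+2)%N /\ (size (Gpolys n).2 <= n.+1)%N.
Proof.
have sX : (size ('X - 'X^2 : {poly R})%R <= 3)%N.
  by rewrite (leq_trans (size_polyD _ _)) // size_polyN size_polyX size_polyXn.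
have sM p N : (size p <= N.+1)%N -> (size (p^`() * ('X - 'X^2))%R <= N.+2)%N.
  move=> sp; have [->|p0] := eqVneq p 0; first by rewrite deriv0 mul0r size_poly0.
  have h1 : (size p^`() <= N)%N by rewrite -ltnS (leq_trans (lt_size_deriv p0)).
  apply: (leq_trans (size_polyMleq _ _)).
  by rewrite -subn1 leq_subLR (leq_trans (leq_add h1 sX)) // addn3 add1n.
elim: n => [|n] /=; first by rewrite size_polyX size_poly0.
case: (Gpolys n) => p q /= [sp sq]; split; first exact: sM.
rewrite (leq_trans (size_polyD _ _)) // geq_max sp sM //.
Qed.

Lemma derive1n_G_bound n :
  exists C, forall t, 0 < t -> t ^+ n * `|derive1n n (@G R) t| <= C * (1 + t) ^+ n.+1.
Proof.
have [sp sq] := size_Gpolys n.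
have [C1 h1] := horner_Gaux_bound sp.
have [C2 h2] := horner_Gaux_bound sq.
exists (C1 + `|C2|) => t t0; rewrite derive1n_GE //.
have tn0 : 0 <= t ^+ n by rewrite exprn_ge0 // ltW.
apply: (le_trans (ler_wpM2l tn0 (ler_normD _ _))).
rewrite mulrDr mulrDl; apply: lerD.
  by rewrite normrM (ger0_norm (ltW t0)) mulrA -exprSr h1.
apply: (le_trans (h2 t t0)).
have t1 : 1 <= 1 + t by rewrite lerDl ltW.
have p0 : 0 <= (1 + t) ^+ n by rewrite exprn_ge0 // (le_trans ler01).
apply: (@le_trans _ _ (`|C2| * (1 + t) ^+ n)); first by rewrite ler_wpM2r // ler_norm.
by rewrite ler_wpM2l // ler_weXn2l.
Qed.

End DerivativesOfG.

(** * Complex-valued integrands, treated componentwise *)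

Section ComplexHalfLine.
Variable R : realType.
Implicit Types (f g : R -> R[i]) (F : R -> R) (a c t M xi : R) (s x z l : R[i]) (n : nat).

Lemma exp_decay_weaken (h : R -> R) M M' c c' : `|M| <= M' -> c' <= c ->
  (forall t, 0 < t -> `|h t| <= M * expR (- (c * t))) ->
  forall t, 0 < t -> `|h t| <= M' * expR (- (c' * t)).
Proof.
move=> MM cc hb t t0; apply: (le_trans (hb t t0)).
apply: (@le_trans _ _ (M' * expR (- (c * t)))).
  by rewrite ler_wpM2r ?expR_ge0 // (le_trans (ler_norm _)).
rewrite ler_wpM2l ?(le_trans _ MM) // ler_expR lerN2 ler_wpM2r // ltW //.
Qed.

Lemma exp_decayD (h k : R -> R) :
  exp_decay h -> exp_decay k -> exp_decay (fun t => h t + k t).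
Proof.
move=> [M [c [c0 hb]]] [N [e [e0 kb]]].
exists (`|M| + `|N|), (Num.min c e); split; first by rewrite lt_min c0.
move=> t t0; apply: (le_trans (ler_normD _ _)); rewrite mulrDl; apply: lerD.
  by apply: (exp_decay_weaken _ _ hb) => //; rewrite ge_min lexx.
by apply: (exp_decay_weaken _ _ kb) => //; rewrite ge_min lexx orbT.
Qed.

Lemma exp_decayZ (r : R) (h : R -> R) : exp_decay h -> exp_decay (fun t => r * h t).
Proof.
move=> [M [c [c0 hb]]]; exists (`|r| * M), c; split => // t t0.
by rewrite normrM -mulrA ler_wpM2l // hb.
Qed.

Lemma half_continuousD (h k : R -> R) :
  half_continuous h -> half_continuous k -> half_continuous (fun t => h t + k t).
Proof. by move=> hc kc t t0; apply: cvgD; [exact: hc|exact: kc]. Qed.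

Lemma half_continuousZ (r : R) (h : R -> R) :
  half_continuous h -> half_continuous (fun t => r * h t).
Proof. by move=> hc t t0; apply: cvgM; [exact: cvg_cst|exact: hc]. Qed.

(** A class of integrands stable under complex linear combinations, on which [cintegral0y] is
    linear. *)
Definition cadm f : Prop :=
  [/\ half_continuous (fun t => complex.Re (f t)),
      half_continuous (fun t => complex.Im (f t)),
      exp_decay (fun t => complex.Re (f t)) &
      exp_decay (fun t => complex.Im (f t))].

Lemma ReM z l : complex.Re (z * l) = complex.Re z * complex.Re l - complex.Im z * complex.Im l.
Proof. by case: z; case: l. Qed.

Lemma ImM z l : complex.Im (z * l) = complex.Re z * complex.Im l + complex.Im z * complex.Re l.
Proof. by case: z; case: l. Qed.

Lemma ReD z l : complex.Re (z + l) = complex.Re z + complex.Re l.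
Proof. by case: z; case: l. Qed.

Lemma ImD z l : complex.Im (z + l) = complex.Im z + complex.Im l.
Proof. by case: z; case: l. Qed.

Lemma ReN z : complex.Re (- z) = - complex.Re z.
Proof. by case: z. Qed.

Lemma eqRI z l : complex.Re z = complex.Re l -> complex.Im z = complex.Im l -> z = l.
Proof. by case: z => ? ?; case: l => ? ? /= -> ->. Qed.

Lemma ReZ_fun z f : (fun t => complex.Re (z * f t)) =
  (fun t => complex.Re z * complex.Re (f t) + (- complex.Im z) * complex.Im (f t)).
Proof. by apply: funext => t; rewrite ReM mulNr. Qed.

Lemma ImZ_fun z f : (fun t => complex.Im (z * f t)) =
  (fun t => complex.Re z * complex.Im (f t) + complex.Im z * complex.Re (f t)).
Proof. by apply: funext => t; rewrite ImM. Qed.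

Lemma ReD_fun f g : (fun t => complex.Re (f t + g t)) =
  (fun t => complex.Re (f t) + complex.Re (g t)).
Proof. by apply: funext => t; rewrite ReD. Qed.

Lemma ImD_fun f g : (fun t => complex.Im (f t + g t)) =
  (fun t => complex.Im (f t) + complex.Im (g t)).
Proof. by apply: funext => t; rewrite ImD. Qed.

Lemma cadmD f g : cadm f -> cadm g -> cadm (fun t => f t + g t).
Proof.
move=> [f1 f2 f3 f4] [g1 g2 g3 g4]; split; rewrite ?ReD_fun ?ImD_fun.
- exact: half_continuousD.
- exact: half_continuousD.
- exact: exp_decayD.
- exact: exp_decayD.
Qed.

Lemma cadmZ z f : cadm f -> cadm (fun t => z * f t).
Proof.
move=> [f1 f2 f3 f4]; split; rewrite ?ReZ_fun ?ImZ_fun.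
- by apply: half_continuousD; apply: half_continuousZ.
- by apply: half_continuousD; apply: half_continuousZ.
- by apply: exp_decayD; apply: exp_decayZ.
- by apply: exp_decayD; apply: exp_decayZ.
Qed.

Lemma cintegral0yD f g : cadm f -> cadm g ->
  cintegral0y (fun t => f t + g t) = cintegral0y f + cintegral0y g.
Proof.
move=> [f1 f2 f3 f4] [g1 g2 g3 g4]; apply: eqRI; rewrite ?ReD ?ImD /=.
  by under eq_Rintegral do rewrite ReD; rewrite RintegralD //; exact: exp_decay_integrable.
by under eq_Rintegral do rewrite ImD; rewrite RintegralD //; exact: exp_decay_integrable.
Qed.

Lemma cintegral0yZ z f : cadm f ->
  cintegral0y (fun t => z * f t) = z * cintegral0y f.
Proof.
move=> [f1 f2 f3 f4]; apply: eqRI; rewrite ?ReM ?ImM /=.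
  under eq_Rintegral do rewrite ReM.
  rewrite RintegralB // ?RintegralZl //; try exact: exp_decay_integrable.
  - by apply: exp_decay_integrable; [exact: half_continuousZ|exact: exp_decayZ].
  - by apply: exp_decay_integrable; [exact: half_continuousZ|exact: exp_decayZ].
under eq_Rintegral do rewrite ImM.
rewrite RintegralD // ?RintegralZl //; try exact: exp_decay_integrable.
- by apply: exp_decay_integrable; [exact: half_continuousZ|exact: exp_decayZ].
- by apply: exp_decay_integrable; [exact: half_continuousZ|exact: exp_decayZ].
Qed.

Definition cderive f t l : Prop :=
  is_derive t 1 (fun u => complex.Re (f u)) (complex.Re l) /\
  is_derive t 1 (fun u => complex.Im (f u)) (complex.Im l).

Lemma cderive_eq f t l l' : cderive f t l -> l = l' -> cderive f t l'.
Proof. by move=> h <-. Qed.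

Lemma cderiveM f g t l l' : cderive f t l -> cderive g t l' ->
  cderive (fun u => f u * g u) t (l * g t + f t * l').
Proof.
move=> [f1 f2] [g1 g2]; split.
  rewrite (_ : (fun u => _) = (fun u => complex.Re (f u)) * (fun u => complex.Re (g u)) -
     (fun u => complex.Im (f u)) * (fun u => complex.Im (g u))); last first.
    by apply: funext => u; rewrite ReM.
  apply: (@is_derive_eq _ _ _ _ _ _ _ _ (is_deriveB (is_deriveM f1 g1) (is_deriveM f2 g2))).
  by rewrite ReD !ReM /GRing.scale /=; ring.
rewrite (_ : (fun u => _) = (fun u => complex.Re (f u)) * (fun u => complex.Im (g u)) +
     (fun u => complex.Im (f u)) * (fun u => complex.Re (g u))); last first.
  by apply: funext => u; rewrite ImM.
apply: (@is_derive_eq _ _ _ _ _ _ _ _ (is_deriveD (is_deriveM f1 g2) (is_deriveM f2 g1))).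
by rewrite ImD !ImM /GRing.scale /=; ring.
Qed.

Lemma cderive_real F t (l : R) : is_derive t 1 F l -> cderive (fun u => (F u)%:C) t l%:C.
Proof. by move=> h; split => //=; exact: is_derive_cst. Qed.

Lemma cderive_cexp F t (l : R) z : is_derive t 1 F l ->
  cderive (fun u => cexp (z * (F u)%:C)) t (z * l%:C * cexp (z * (F t)%:C)).
Proof.
move=> h; have hr := is_deriveZ (complex.Re z) h; have hi := is_deriveZ (complex.Im z) h.
have he := @is_derive1_comp R expR _ t _ _ (is_derive_expR _) hr.
have hc := @is_derive1_comp R (@cos R) _ t _ _ (is_derive_cos _) hi.
have hs := @is_derive1_comp R (@sin R) _ t _ _ (is_derive_sin _) hi.
have rE u : complex.Re (z * (F u)%:C) = complex.Re z * F u by rewrite ReM /= mulr0 subr0.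
have iE u : complex.Im (z * (F u)%:C) = complex.Im z * F u by rewrite ImM /= mulr0 add0r.
split.
  rewrite (_ : (fun u => _) = (expR \o (fun u => complex.Re z * F u)) *
    (@cos R \o (fun u => complex.Im z * F u))); last first.
    by apply: funext => u; rewrite /cexp rE iE.
  apply: (@is_derive_eq _ _ _ _ _ _ _ _ (is_deriveM he hc)).
  by rewrite !ReM !ImM /cexp rE iE /= /GRing.scale /=; ring.
rewrite (_ : (fun u => _) = (expR \o (fun u => complex.Re z * F u)) *
  (@sin R \o (fun u => complex.Im z * F u))); last first.
  by apply: funext => u; rewrite /cexp rE iE.
apply: (@is_derive_eq _ _ _ _ _ _ _ _ (is_deriveM he hs)).
by rewrite !ImM !ReM /cexp rE iE /= /GRing.scale /=; ring.
Qed.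

Lemma Rintegral_derive_decay0 (h H : R -> R) M :
  (forall t, 0 < t -> is_derive t 1 H (h t)) -> half_continuous h ->
  exp_decay h -> exp_decay H -> (forall t, 0 < t -> `|H t| <= M * t) ->
  (\int[lebesgue_measure]_(t in `]0, +oo[%classic) h t)%R = 0.
Proof.
move=> dH hc [M1 [c1 [c10 b1]]] [M2 [c2 [c20 b2]]] b3.
have c0 : 0 < Num.min c1 c2 by rewrite lt_min c10.
apply: (@Rintegral_derive0 R h H (`|M1| + `|M2| + `|M|) _ c0 dH hc).
- by apply: (exp_decay_weaken _ _ b1); rewrite ?ge_min ?lexx // -addrA lerDl addr_ge0.
- by apply: (exp_decay_weaken _ _ b2); rewrite ?ge_min ?lexx ?orbT // addrAC lerDr addr_ge0.
- move=> t t0; apply: (le_trans (b3 t t0)); rewrite ler_wpM2r // ?(ltW t0) //.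
  by rewrite (le_trans (ler_norm _)) // lerDr addr_ge0.
Qed.

Lemma cintegral0y_derive0 f g M : (forall t, 0 < t -> cderive f t (g t)) ->
  cadm g -> cadm f ->
  (forall t, 0 < t -> `|complex.Re (f t)| <= M * t /\ `|complex.Im (f t)| <= M * t) ->
  cintegral0y g = 0.
Proof.
move=> dfg [g1 g2 g3 g4] [_ _ f3 f4] fb; apply: eqRI => /=.
  apply: (@Rintegral_derive_decay0 _ (fun t => complex.Re (f t)) M) => // t t0.
    by case: (dfg t t0).
  by case: (fb t t0).
apply: (@Rintegral_derive_decay0 _ (fun t => complex.Im (f t)) M) => // t t0.
  by case: (dfg t t0).
by case: (fb t t0).
Qed.

End ComplexHalfLine.

(** * The integral transform with kernel [t^(s-1) e^(-xt)] and integration by parts *)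

Section LaplaceMellin.
Variable R : realType.
Implicit Types (F : R -> R) (a t xi : R) (s x z : R[i]) (n B : nat).

Lemma exprn1D_le_expR xi B : 0 < xi ->
  exists M, 0 <= M /\ forall t, 0 < t -> (1 + t) ^+ B <= M * expR (xi * t).
Proof.
(* Bound [1 + t] by [(1 + 1/e) e^(e t)] and take the [B]-th power. The choice of [e] gives
   [B e <= xi], and [B.+1] avoids dividing by 0 when [B = 0]. *)
move=> xi0; pose e := xi / B.+1%:R.
have B0 : 0 < B.+1%:R :> R by rewrite ltr0n.
have e0 : 0 < e by rewrite divr_gt0.
exists ((1 + e^-1) ^+ B); split; first by rewrite exprn_ge0 // addr_ge0 // invr_ge0 ltW.
move=> t t0.
have h : 1 + t <= (1 + e^-1) * expR (e * t).
  apply: (@le_trans _ _ ((1 + e^-1) * (1 + e * t))); last first.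
    by rewrite ler_wpM2l ?expR_ge1Dx // addr_ge0 // invr_ge0 ltW.
  rewrite (_ : (1 + e^-1) * _ = 1 + t + (e * t + e^-1)); last first.
    by field; rewrite gt_eqF.
  by rewrite lerDl addr_ge0 // ltW // ?mulr_gt0 ?invr_gt0.
have t1 : 0 <= 1 + t by rewrite addr_ge0 // ltW.
apply: (@le_trans _ _ (((1 + e^-1) * expR (e * t)) ^+ B)).
  by rewrite lerXn2r // nnegrE (le_trans t1).
rewrite exprMn ler_wpM2l //; first by rewrite exprn_ge0 // addr_ge0 // invr_ge0 ltW.
rewrite -expRM_natl ler_expR mulrA ler_wpM2r ?(ltW t0) //.
by rewrite /e mulrCA ger_pMr // ler_pdivrMr // mul1r ler_nat.
Qed.

(** At worst a pole of order [n] at 0, and polynomial growth at infinity. Orders add under products,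
    matching the sum of the differentiation orders in [Z]. *)
Definition pole_growth n F : Prop :=
  exists C B, forall t, 0 < t -> t ^+ n * `|F t| <= C * (1 + t) ^+ B.

(** Split [t^a] as [t^n t^(a-n)]: the first factor compensates the pole, and the second is at most a
    power of [1 + t]. Half of the exponential rate absorbs all powers of [1 + t], the other half
    remains as decay. *)
Lemma pole_growth_decay n F a xi : pole_growth n F -> n%:R <= a -> 0 < xi ->
  exp_decay (fun t => F t * expR (a * ln t - xi * t)).
Proof.
move=> [C [B Fb]] na xi0.
have xi2 : 0 < xi / 2 by rewrite divr_gt0.
pose K := Num.bound (a - n%:R).
have [M [M0 hM]] := exprn1D_le_expR (B + K) xi2.
exists (`|C| * M), (xi / 2); split => // t t0.
have t1 : 1 <= 1 + t by rewrite lerDl ltW.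
have t1' : 0 < 1 + t by exact: lt_le_trans t1.
have hK : expR ((a - n%:R) * ln t) <= (1 + t) ^+ K.
  rewrite -[X in X ^+ K](@lnK R (1 + t)) ?posrE // -expRM_natl ler_expR.
  apply: (@le_trans _ _ ((a - n%:R) * ln (1 + t))).
    by rewrite ler_wpM2l ?subr_ge0 // ler_ln ?posrE // lerDr.
  rewrite ler_wpM2r ?ln_ge0 // ltW // archi_boundP // subr_ge0 //.
have eE : expR (a * ln t - xi * t) =
    t ^+ n * expR ((a - n%:R) * ln t) * expR (- (xi * t)).
  rewrite -[X in X ^+ n](@lnK R t) ?posrE // -expRM_natl -!expRD; congr expR; ring.
rewrite normrM (ger0_norm (expR_ge0 _)) eE.
apply: (@le_trans _ _ (`|C| * (1 + t) ^+ B * (1 + t) ^+ K * expR (- (xi * t)))).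
  rewrite !mulrA ler_wpM2r ?expR_ge0 // ler_pM ?expR_ge0 //.
    by rewrite mulr_ge0 // exprn_ge0 // ltW.
  rewrite mulrC (le_trans (Fb t t0)) // ler_wpM2r ?ler_norm // exprn_ge0 // ltW //.
rewrite -!mulrA ler_wpM2l // mulrA -exprD.
apply: (@le_trans _ _ (M * expR (xi / 2 * t) * expR (- (xi * t)))).
  by rewrite ler_wpM2r ?expR_ge0 // hM.
by rewrite -mulrA -expRD ler_wpM2l // ler_expR; lra.
Qed.

Lemma ReCM (r : R) z : complex.Re (r%:C * z) = r * complex.Re z.
Proof. by rewrite ReM /= mul0r subr0. Qed.

Lemma ImCM (r : R) z : complex.Im (r%:C * z) = r * complex.Im z.
Proof. by rewrite ImM /= mul0r addr0. Qed.

Lemma Re_cexp z : complex.Re (cexp z) = expR (complex.Re z) * cos (complex.Im z).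
Proof. by []. Qed.

Lemma Im_cexp z : complex.Im (cexp z) = expR (complex.Re z) * sin (complex.Im z).
Proof. by []. Qed.

Lemma cexpD z (w : R[i]) : cexp (z + w) = cexp z * cexp w.
Proof.
apply: eqRI; rewrite ?ReM ?ImM /cexp /= ReD ImD expRD ?cosD ?sinD; ring.
Qed.

Definition kernel_fun x s F t : R[i] :=
  rcpow t (s - 1) * (F t)%:C * cexp (- (x * t%:C)).

Lemma kernel_funE x s F t : kernel_fun x s F t =
  (F t)%:C * cexp ((s - 1) * (ln t)%:C - x * t%:C).
Proof. by rewrite /kernel_fun /rcpow cexpD mulrA [_ * (F t)%:C]mulrC. Qed.

Lemma kernel_fun_bound x s F t :
  let b := `|F t * expR ((complex.Re s - 1) * ln t - complex.Re x * t)| in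
  `|complex.Re (kernel_fun x s F t)| <= b /\ `|complex.Im (kernel_fun x s F t)| <= b.
Proof.
have rE : complex.Re ((s - 1) * (ln t)%:C - x * t%:C) =
    (complex.Re s - 1) * ln t - complex.Re x * t.
  by rewrite ReD ReN !ReM /= ReD ReN /=; ring.
move=> b; rewrite /b kernel_funE; split.
  rewrite ReCM Re_cexp rE mulrA normrM ler_piMr //.
  by rewrite ler_norml cos_geN1 cos_le1.
rewrite ImCM Im_cexp rE mulrA normrM ler_piMr //.
by rewrite ler_norml sin_geN1 sin_le1.
Qed.

Lemma kernel_fun_shift x s F t : 0 < t ->
  kernel_fun x s F t = t%:C * kernel_fun x (s - 1) F t.
Proof.
move=> t0; rewrite !kernel_funE mulrCA; congr (_ * _).
have -> : t%:C = cexp (ln t)%:C :> R[i].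
  by rewrite /cexp /= lnK ?posrE // cos0 sin0 mulr1 mulr0.
rewrite -cexpD; congr cexp; ring.
Qed.

Lemma cderive_kernel_fun x s F t (l : R) : 0 < t -> is_derive t 1 F l ->
  cderive (kernel_fun x s F) t
    (rcpow t (s - 1) * l%:C * cexp (- (x * t%:C)) +
     ((s - 1) * kernel_fun x (s - 1) F t + - x * kernel_fun x s F t)).
Proof.
move=> t0 dF.
have d1 := cderive_cexp (s - 1) (is_derive1_ln t0).
have d2 := cderive_cexp (- x) (is_derive_id t 1).
have d3 := cderiveM (cderiveM d1 (cderive_real dF)) d2.
rewrite (_ : kernel_fun x s F = (fun u => cexp ((s - 1) * (ln u)%:C) * (F u)%:C *
  cexp (- x * (id u)%:C))); last first.
  by apply: funext => u; rewrite /kernel_fun mulNr.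
apply: (cderive_eq d3).
have E : kernel_fun x (s - 1) F t = (t^-1)%:C * kernel_fun x s F t.
  by rewrite (kernel_fun_shift x s F t0) mulrA -rmorphM /= mulVf ?gt_eqF // mul1r.
rewrite E /kernel_fun /rcpow /= mulNr; ring.
Qed.

Lemma cderive_half_continuous (f : R -> R[i]) (g : R -> R[i]) :
  (forall t, 0 < t -> cderive f t (g t)) ->
  half_continuous (fun t => complex.Re (f t)) /\ half_continuous (fun t => complex.Im (f t)).
Proof.
by move=> h; split => t t0; have [h1 h2] := h t t0; exact: is_derive_continuous.
Qed.

Lemma cadm_kernel_fun x s F (F' : R -> R) n : 0 < complex.Re x ->
  n%:R <= complex.Re s - 1 -> pole_growth n F ->
  (forall t, 0 < t -> is_derive t 1 F (F' t)) -> cadm (kernel_fun x s F).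
Proof.
move=> x0 ns pF dF.
have [c1 c2] := cderive_half_continuous
  (fun t (t0 : 0 < t) => cderive_kernel_fun x s t0 (dF t t0)).
have [M [c [c0 hM]]] := pole_growth_decay pF ns x0.
split => //; exists M, c; split => // t t0;
  have [b1 b2] := kernel_fun_bound x s F t; exact: le_trans (hM t t0).
Qed.

Definition laplace_mellin x s F : R[i] := cintegral0y (kernel_fun x s F).

(** The condition on [Re s] lets the kernel with exponent [s - 2] still compensate a pole of order
    [n], so all three integrals converge. The function [F''] serves to make [F'] continuous. *)
Lemma laplace_mellin_parts x s F (F' F'' : R -> R) n : 0 < complex.Re x ->
  n.+1%:R <= complex.Re s - 1 -> pole_growth n F -> pole_growth n.+1 F' ->
  (forall t, 0 < t -> is_derive t 1 F (F' t)) ->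
  (forall t, 0 < t -> is_derive t 1 F' (F'' t)) ->
  laplace_mellin x s F' =
    x * laplace_mellin x s F - (s - 1) * laplace_mellin x (s - 1) F.
Proof.
move=> x0 ns pF pF' dF dF'.
have ns1 : n%:R <= complex.Re s - 1 by apply: le_trans ns; rewrite ler_nat.
have ns2 : n%:R <= complex.Re (s - 1) - 1.
  by move: ns; rewrite ReD ReN /= -natr1; lra.
have a1 := cadm_kernel_fun x0 ns1 pF dF.
have a2 := cadm_kernel_fun x0 ns2 pF dF.
have a3 := cadm_kernel_fun x0 ns pF' dF'.
have [M [c [c0 hM]]] := pole_growth_decay pF ns2 x0.
have M0 : 0 <= M.
  have := le_trans (normr_ge0 _) (hM 1 ltr01).
  by rewrite pmulr_lge0 ?expR_gt0.
(* The integrand is the derivative of [kernel_fun x s F]. *)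
have h : cintegral0y (fun t => kernel_fun x s F' t +
     ((s - 1) * kernel_fun x (s - 1) F t + - x * kernel_fun x s F t)) = 0.
  apply: (@cintegral0y_derive0 R (kernel_fun x s F) _ M).
  - by move=> t t0; exact: (cderive_kernel_fun x s t0 (dF t t0)).
  - by apply: cadmD => //; apply: cadmD; apply: cadmZ.
  - by [].
  (* The boundary term at 0 vanishes linearly: the kernel at [s] is [t] times the kernel at [s - 1],
     which is bounded by [M]. *)
  - move=> t t0; rewrite (kernel_fun_shift x s F t0) ReCM ImCM.
    have [b1 b2] := kernel_fun_bound x (s - 1) F t.
    have hb : `|F t * expR ((complex.Re (s - 1) - 1) * ln t - complex.Re x * t)| <= M.
      apply: (le_trans (hM t t0)); rewrite ler_piMr // -expR0 ler_expR oppr_le0.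
      by rewrite mulr_ge0 // ltW.
    rewrite !normrM (gtr0_norm t0) ![t * _]mulrC.
    by split; rewrite ler_wpM2r ?(ltW t0) // (le_trans _ hb).
move: h; rewrite cintegral0yD // ?cintegral0yD ?cintegral0yZ //; try exact: cadmZ; last first.
  by apply: cadmD; apply: cadmZ.
move=> /eqP; rewrite addr_eq0 => /eqP h.
by rewrite /laplace_mellin h; ring.
Qed.

Lemma cGammaE s : cGamma s = laplace_mellin 1 s (fun=> 1).
Proof.
by congr cintegral0y; apply: funext => t; rewrite /kernel_fun mulr1 mul1r.
Qed.

(** The case [x = 1], [F = 1] of [laplace_mellin_parts]: since [F' = 0], the left-hand side there is
    0. *)
Lemma cGammaS s : 2 <= complex.Re s -> cGamma s = (s - 1) * cGamma (s - 1).
Proof.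
move=> s2; have p0 : pole_growth 0 (fun=> 1 : R).
  by exists 1, 0 => t _; rewrite !expr0 normr1.
have p1 : pole_growth 1 (fun=> 0 : R).
  by exists 0, 0 => t _; rewrite normr0 mulr0 mul0r.
have := @laplace_mellin_parts 1 s (fun=> 1) (fun=> 0) (fun=> 0) 0.
rewrite /= ltr01 => /(_ isT) h.
have {h} := h _ p0 p1 (fun t _ => is_derive_cst _ _ _) (fun t _ => is_derive_cst _ _ _).
rewrite !cGammaE mul1r => h; apply/esym/eqP; rewrite -subr_eq0 -opprB oppr_eq0 -h; last by lra.
rewrite /laplace_mellin /cintegral0y.
have E t : kernel_fun 1 s (fun=> 0) t = 0 by rewrite /kernel_fun mulr0 mul0r.
under eq_Rintegral do rewrite E.
under [X in _ +i* X]eq_Rintegral do rewrite E.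
by rewrite /= !Rintegral_cst // !mul0r.
Qed.

End LaplaceMellin.

(** * Products of derivatives of [G], and the recurrence for [Z] *)

Lemma is_derive_prod_ord (R : realType) (d : nat) (f : 'I_d -> R -> R)
    (df : 'I_d -> R) (t : R) :
  (forall i, is_derive t 1 (f i) (df i)) ->
  is_derive t 1 (fun u => \prod_(i < d) f i u)
    (\sum_(i < d) \prod_(j < d) (if j == i then df j else f j t)).
Proof.
elim: d f df => [|d IH] f df hf.
  rewrite big_ord0 (_ : (fun u => _) = cst 1); first exact: is_derive_cst.
  by apply: funext => u; rewrite big_ord0.
rewrite (_ : (fun u => _) = f ord0 * (fun u => \prod_(i < d) f (lift ord0 i) u)); last first.
  by apply: funext => u; rewrite big_ord_recl.
apply: (@is_derive_eq _ _ _ _ _ _ _ _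
  (is_deriveM (hf ord0) (IH _ _ (fun i => hf (lift ord0 i))))).
rewrite [RHS]big_ord_recl addrC /GRing.scale /=; congr (_ + _).
  by rewrite big_ord_recl eqxx mulrC; congr (_ * _); apply: eq_bigr.
rewrite mulr_sumr; apply: eq_bigr => i _; by rewrite big_ord_recl.
Qed.

Section ProductOfDerivatives.
Variable R : realType.

Definition prodG (d : nat) (n : 'I_d -> nat) (t : R) : R :=
  \prod_(i < d) derive1n (n i) (@G R) t.

Lemma is_derive_prodG (d : nat) (n : 'I_d -> nat) (t : R) : 0 < t ->
  is_derive t 1 (prodG n) (\sum_(i < d) prodG (incr i n) t).
Proof.
move=> t0.
apply: (@is_derive_eq _ _ _ _ _ _ _ _
  (is_derive_prod_ord (fun i => is_derive_derive1n_G (n i) t0))).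
apply: eq_bigr => i _; apply: eq_bigr => j _; rewrite /incr.
by case: eqP => _; rewrite ?addn1 ?addn0.
Qed.

Lemma pole_growth_prod (d : nat) (n : 'I_d -> nat) (f : 'I_d -> R -> R) :
  (forall i, pole_growth (n i) (f i)) ->
  pole_growth (\sum_(i < d) n i) (fun t => \prod_(i < d) f i t).
Proof.
elim: d n f => [|d IH] n f hf.
  by exists 1, 0 => t t0; rewrite !big_ord0 !expr0 normr1.
have [C1 [B1 h1]] := hf ord0.
have [C2 [B2 h2]] := IH _ _ (fun i => hf (lift ord0 i)).
exists (C1 * C2), (B1 + B2)%N => t t0.
rewrite !big_ord_recl !exprD normrM mulrACA [leRHS]mulrACA.
have t0' := ltW t0.
by apply: ler_pM; rewrite ?h1 ?h2 // mulr_ge0 // exprn_ge0.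
Qed.

Lemma pole_growth_sum (d n : nat) (f : 'I_d -> R -> R) :
  (forall i, pole_growth n (f i)) ->
  pole_growth n (fun t => \sum_(i < d) f i t).
Proof.
elim: d f => [|d IH] f hf.
  by exists 0, 0 => t t0; rewrite big_ord0 normr0 mulr0 mul0r.
have [C1 [B1 h1]] := hf ord0.
have [C2 [B2 h2]] := IH _ (fun i => hf (lift ord0 i)).
exists (`|C1| + `|C2|), (B1 + B2)%N => t t0.
have t0' := ltW t0; have t1 : 1 <= 1 + t by rewrite lerDl.
rewrite big_ord_recl /=.
apply: (le_trans (ler_wpM2l (exprn_ge0 _ t0') (ler_normD _ _))).
rewrite mulrDr mulrDl; apply: lerD.
  apply: (le_trans (h1 t t0)); apply: (le_trans (ler_wpM2r _ (ler_norm _))).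
    by rewrite exprn_ge0 // (le_trans ler01).
  by rewrite ler_wpM2l // ler_weXn2l // leq_addr.
apply: (le_trans (h2 t t0)); apply: (le_trans (ler_wpM2r _ (ler_norm _))).
  by rewrite exprn_ge0 // (le_trans ler01).
by rewrite ler_wpM2l // ler_weXn2l // leq_addl.
Qed.

Lemma pole_growth_prodG (d : nat) (n : 'I_d -> nat) :
  pole_growth (\sum_(i < d) n i) (prodG n).
Proof.
apply: pole_growth_prod => i; have [C h] := derive1n_G_bound R (n i).
by exists C, (n i).+1.
Qed.

Lemma ZE (d : nat) (n : 'I_d -> nat) (s x : R[i]) :
  Z n s x = (cGamma s)^-1 * laplace_mellin x s (prodG n).
Proof. by []. Qed.

Lemma laplace_mellin_sum (d n : nat) (s x : R[i]) (f df : 'I_d -> R -> R) :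
  0 < complex.Re x -> n%:R <= complex.Re s - 1 ->
  (forall i, pole_growth n (f i)) ->
  (forall i (t : R), 0 < t -> is_derive t 1 (f i) (df i t)) ->
  laplace_mellin x s (fun t => \sum_(i < d) f i t) =
  \sum_(i < d) laplace_mellin x s (f i).
Proof.
move=> x0 ns; elim: d f df => [|d IH] f df pf hd.
  rewrite big_ord0 (_ : (fun t => _) = fun=> 0); last first.
    by apply: funext => t; rewrite big_ord0.
  have := @cintegral0yZ R 0 (kernel_fun x s (fun=> 0)).
  rewrite mul0r => h; rewrite /laplace_mellin -[RHS]h.
    by congr cintegral0y; apply: funext => t; rewrite /kernel_fun mulr0 !mul0r.
  apply: (@cadm_kernel_fun _ _ _ _ (fun=> 0) n) => //.
  by exists 0, 0 => t _; rewrite normr0 mulr0 mul0r.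
rewrite big_ord_recl -(IH _ (fun i => df (lift ord0 i))) //.
rewrite -cintegral0yD.
- by congr cintegral0y; apply: funext => t; rewrite /kernel_fun big_ord_recl rmorphD /=; ring.
- exact: (cadm_kernel_fun x0 ns (pf ord0) (hd ord0)).
- apply: (@cadm_kernel_fun _ _ _ _ (fun t => \sum_(i < d) df (lift ord0 i) t) n) => //.
    exact: pole_growth_sum.
  move=> t t0; rewrite (_ : (fun t => _) = \sum_(i < d) f (lift ord0 i)).
    by apply: is_derive_sum => i; exact: hd.
  by apply: funext => u; rewrite fct_sumE.
Qed.

(** Integration by parts for [F = prodG n], whose derivative is the sum of the [prodG (incr i n)],
    normalised by the functional equation of Gamma. *)
Lemma Z_recurrence (d : nat) (n : 'I_d -> nat) (s x : R[i]) :
  (1 <= d)%N -> 0 < complex.Re x ->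
  (1 + \sum_(i < d) n i + d)%N%:R < complex.Re s ->
  \sum_(i < d) Z (incr i n) s x = x * Z n s x - Z n (s - 1) x.
Proof.
move=> d1 x0 hs.
have ns : (\sum_(i < d) n i).+1%:R <= complex.Re s - 1.
  (* Here [1 <= d] supplies the unit lost in passing from [Re s] to [Re s - 1]. *)
  have h : (\sum_(i < d) n i)%N.+1%:R + 1 <= (1 + \sum_(i < d) n i + d)%N%:R :> R.
    by rewrite natr1 ler_nat add1n -[leqLHS]addn1 leq_add2l.
  lra.
have s1 : 1 <= complex.Re s - 1.
  by apply: le_trans ns; rewrite ler1n.
have sn1 : s - 1 != 0.
  apply/eqP => h; have := congr1 (@complex.Re R) h; rewrite ReD ReN /= => h'; lra.
have pi i : pole_growth (\sum_(j < d) n j).+1 (prodG (incr i n)).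
  by rewrite -(sum_incr i n); exact: pole_growth_prodG.
have hd i (t : R) : 0 < t ->
    is_derive t 1 (prodG (incr i n)) (\sum_(j < d) prodG (incr j (incr i n)) t).
  exact: is_derive_prodG.
have -> : \sum_(i < d) Z (incr i n) s x =
    (cGamma s)^-1 * laplace_mellin x s (fun t => \sum_(i < d) prodG (incr i n) t).
  rewrite (laplace_mellin_sum x0 ns pi hd) mulr_sumr.
  by apply: eq_bigr => i _; rewrite ZE.
have hd2 (t : R) : 0 < t -> is_derive t 1 (fun t => \sum_(i < d) prodG (incr i n) t)
    (\sum_(i < d) \sum_(j < d) prodG (incr j (incr i n)) t).
  move=> t0; rewrite (_ : (fun t => _) = \sum_(i < d) prodG (incr i n)).
    by apply: is_derive_sum => i; exact: hd.
  by apply: funext => u; rewrite fct_sumE.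
rewrite (laplace_mellin_parts x0 ns (pole_growth_prodG n) (pole_growth_sum pi)
  (is_derive_prodG n) hd2).
rewrite !ZE (@cGammaS R s); last by lra.
(* The factor [s - 1] from the integration by parts cancels the one in [cGamma s], by [sn1]. *)
by rewrite mulrBr mulrCA; congr (_ - _); rewrite invfM mulrACA mulVf // mul1r.
Qed.

(** Induction on [m] with [k] general: [composition_sumS] moves one unit from the composition into
    [k], which leaves [m + \sum_i k i] and hence the condition on [Re s] unchanged. *)
Lemma composition_sum_Z (d m N : nat) (k : 'I_d -> nat) (x s : R[i]) :
  (1 <= d)%N -> 0 < complex.Re x -> (m <= N)%N ->
  (m + \sum_(i < d) k i + d)%N%:R < complex.Re s ->
  m`!%:R * composition_sum N m (fun p => Z (fun i => (p i + k i)%N) s x) =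
  \sum_(j < m.+1) ('C(m, j))%:R * (-1) ^+ j * x ^+ (m - j) * Z k (s - j%:R) x.
Proof.
move=> d1 x0; elim: m k => [|m IH] k mN hs.
  rewrite big_ord1 fact0 mul1r bin0 !expr0 !mul1r mulr0n subr0.
  rewrite /composition_sum (big_pred1 [ffun=> ord0]) /=.
    rewrite big1 ?mul1r => [|i _]; last by rewrite ffunE fact0 invr1.
    by apply: (congr1 (fun q => Z q s x)); apply: funext => i; rewrite ffunE.
  move=> p; rewrite sum_nat_eq0; apply/forallP/eqP => [h|-> i]; last by rewrite ffunE.
  by apply/ffunP => i; rewrite ffunE; apply: val_inj; apply/eqP; exact: h.
rewrite factS mulnC natrM -mulrA composition_sumS // mulr_sumr.
transitivity (\sum_(i < d) \sum_(j < m.+1)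
  ('C(m, j))%:R * (-1) ^+ j * x ^+ (m - j) * Z (incr i k) (s - j%:R) x).
  apply: eq_bigr => i _; rewrite -IH; [|exact: ltnW|].
    congr (_ * _); apply: (congr1 (composition_sum N m)); apply: funext => p.
    apply: (congr1 (fun q => Z q s x)); apply: funext => j.
    by rewrite /incr -addnA [((_ == _) + _)%N]addnC addnA.
  by rewrite sum_incr addnS -addSn.
rewrite exchange_big /=.
have step (j : 'I_m.+1) :
  \sum_(i < d) ('C(m, j))%:R * (-1) ^+ j * x ^+ (m - j) * Z (incr i k) (s - j%:R) x =
   ('C(m, j))%:R * (-1) ^+ j * x ^+ (m.+1 - j) * Z k (s - j%:R) x +
   ('C(m, j))%:R * (-1) ^+ j.+1 * x ^+ (m - j) * Z k (s - j.+1%:R) x.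
  rewrite -mulr_sumr Z_recurrence //; last first.
    (* Since [j <= m], the original bound on [Re s] leaves enough room for the recurrence at
       [s - j]. *)
    rewrite ReD ReN.
    have -> : complex.Re (j%:R : R[i]) = j%:R :> R.
      by rewrite -(rmorph_nat (real_complex R)).
    rewrite ltrBrDr -natrD; apply: le_lt_trans hs; rewrite ler_nat.
    by rewrite addnC !addnA addn1 !leq_add2r ltn_ord.
  have -> : s - j%:R - 1 = s - j.+1%:R by rewrite -natr1; ring.
  have jm : (j <= m)%N by rewrite -ltnS ltn_ord.
  by rewrite (subSn jm) !exprS; ring.
under eq_bigr do rewrite step.
rewrite big_split /=.
(* The two sums are offset by one: the first term of one and the last term of the other stand alone,
   and the remaining terms pair up by Pascal's rule [binS]. *)
rewrite big_ord_recl [RHS]big_ord_recl /= -!addrA; congr (_ + _); first by rewrite !bin0.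
rewrite [X in _ + X]big_ord_recr /= [RHS]big_ord_recr /= addrA; congr (_ + _).
  rewrite -big_split /=; apply: eq_bigr => j _; rewrite /bump /= !add1n.
  by rewrite binS natrD subSS; ring.
by rewrite /bump /= add1n !binn subSS.
Qed.

End ProductOfDerivatives.

(** * From inverse factorial weights to multinomial coefficients *)

(** The integer quotient in [multinomial] is exact by [prod_fact_dvd], so it agrees with division in
    the field. *)
Lemma multinomial_natr (F : numFieldType) (m d : nat) (p : 'I_d -> nat) :
  (\sum_(i < d) p i)%N = m ->
  (multinomial m p)%:R = m`!%:R * \prod_(i < d) ((p i)`!%:R)^-1 :> F.
Proof.
move=> <-; have h := prod_fact_dvd (index_enum 'I_d) p.
have h0 : (\prod_(i < d) (p i)`!)%N%:R != 0 :> F.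
  by rewrite pnatr_eq0 -lt0n prodn_gt0 // => i; exact: fact_gt0.
apply: (mulIf h0); rewrite -natrM divnK // -mulrA prodfV -natr_prod mulVf ?mulr1 //.
Qed.

Theorem theorem4 (R : realType) (d : nat) (m : nat) (k : 'I_d -> nat)
    (x s : R[i]) :
  (1 <= d)%N ->
  0 < complex.Re x ->
  (m + \sum_(i < d) k i + d)%N%:R < complex.Re s ->
  \sum_(p : {ffun 'I_d -> 'I_m.+1} | (\sum_(i < d) p i)%N == m)
      (multinomial m (fun i => p i : nat))%:R *
      Z (fun i => (p i + k i)%N) s x =
  \sum_(j < m.+1)
      ('C(m, j))%:R * (-1) ^+ j * x ^+ (m - j) * Z k (s - j%:R) x.
Proof.
move=> d1 x0 hs; rewrite -(@composition_sum_Z R d m m k x s) //.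
rewrite /composition_sum mulr_sumr; apply: eq_bigr => p /eqP hp.
by rewrite multinomial_natr // mulrA.
Qed.
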